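(* Let $N$ be a finite set of agents, $O$ a finite set of objects with copy numbers $(q_x)_{x\in O}$ satisfying $\sum_{x\in O}q_x\ge|N|$, and let $\mathcal{U}$ be the domain of all profiles of injective utility functions $u_i:O\to\mathbb{R}$, $i\in N$. Let $f:\mathcal{U}\to\Delta(\mathcal{M})$ be a random assignment rule on $\mathcal{U}$. Then $f$ satisfies equal-treatment-of-equals on $\mathcal{U}$, ex-post efficiency, and probabilistic monotonicity if and only if $f$ is the Random Priority rule, i.e. $f(u)=RP(R^u)$ for all $u\in\mathcal{U}$.
   Context: Setting. $N$ is a finite set of $n=|N|$ agents, $O$ a finite set of objects; object $x\in O$ has $q_x\geq 1$ copies, and $\sum_{x\in O}q_x\ge|N|$. $\mathcal{U}^i$ is the set of von Neumann–Morgenstern utility functions $u_i:O\to\mathbb{R}$ with $u_i(x)\ne u_i(y)$ whenever $x\ne y$, and $\mathcal{U}=\times_{i\in N}\mathcal{U}^i$. For $u\in\mathcal{U}$, the associated strict preference $R^u_i$ is the linear order on $O$ with $x\,R^u_i\,y\iff u_i(x)\ge u_i(y)$, and $R^u=(R^u_i)_{i\in N}$. For a linear order $R_i$ with asymmetric part $P_i$, $U(x,R_i)=\{y\in O:y\,P_i\,x\}$. An assignment is a map $\mu:N\to O$ with $|\{i:\mu_i=x\}|\le q_x$ for all $x$; $\mathcal{M}$ is the set of assignments. $\mu$ is efficient under $R$ if there is no $\mu'\in\mathcal{M}$ with $\mu'_iR_i\mu_i$ for all $i$ and $\mu'_jP_j\mu_j$ for some $j$. $\Delta(\mathcal{M})$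 is the set of probability distributions on $\mathcal{M}$; $f_\mu(u)$ is the probability of $\mu$ under $f(u)$. Axioms for $f:\mathcal{U}\to\Delta(\mathcal{M})$: - Ex-post efficiency: for all $u\in\mathcal{U}$, $f_\mu(u)>0$ implies $\mu$ is efficient under $R^u$. - Equal-treatment-of-equals on $\mathcal{U}$: for all $u\in\mathcal{U}$, all $i,j\in N$ with $u_i=u_j$ (equality of utility functions), and all $\mu,\mu'\in\mathcal{M}$ with $\mu_i=\mu'_j$, $\mu_j=\mu'_i$, $\mu_k=\mu'_k$ for $k\ne i,j$, one has $f_\mu(u)=f_{\mu'}(u)$. - Probabilistic monotonicity: for all $u,u'\in\mathcal{U}$ and $\mu\in\mathcal{M}$ such that $U(\mu_i,R^{u'}_i)\subseteq U(\mu_i,R^u_i)$ for all $i\in N$, one has $f_\mu(u')\ge f_\mu(u)$. Random Priority. For a profile $R$ of linear orders on $O$ and a strict linear order $\rhd$ on $N$, $f^\rhd(R)$ is the assignment in which agents, one after another in order of $\rhd$, receive their most-preferred object among those with at least one copy still available. $RP(R)=\frac{1}{n!}\sum_{\rhd}f^\rhd(R)$, the sum being over all strict linear orders on $N$ (each $f^\rhd(R)$ viewed as a point mass). *)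

(* Defs.v *)
From HB Require Import structures.
From mathcomp Require Import all_boot all_order all_algebra reals.

Set Implicit Arguments.
Unset Strict Implicit.
Unset Printing Implicit Defensive.

Import Order.TTheory GRing.Theory Num.Theory.
Local Open Scope ring_scope.

Record linear_order (T : finType) := LinearOrder {
  weak :> rel T;
  weak_refl : reflexive weak;
  weak_anti : antisymmetric weak;
  weak_trans : transitive weak;
  weak_total : total weak }.

Definition strict (T : finType) (r : linear_order T) : rel T :=
  fun x y => r x y && ~~ r y x.

Definition upper (T : finType) (x : T) (r : linear_order T) : {set T} :=
  [set y | strict r y x].

Section Utilities.
Variables (R : realType) (O : finType).

(* Finite functions with a boolean side condition, so that Leibniz equality of
   utilities (and of profiles below) is pointwise equality. *)
Record utility := Utility {
  util :> {ffun O -> R};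
  _ : injectiveb util }.
HB.instance Definition _ := [isSub for util].

Definition pref_rel (u : utility) : rel O := fun x y => u y <= u x.

Fact pref_refl u : reflexive (pref_rel u).
Proof. by move=> x; rewrite /pref_rel lexx. Qed.

Fact pref_anti u : antisymmetric (pref_rel u).
Proof.
move=> x y; rewrite /pref_rel => /le_anti.
by case: u => u /= /injectiveP inj_u /inj_u.
Qed.

Fact pref_trans u : transitive (pref_rel u).
Proof. by move=> y x z /[swap]; apply: le_trans. Qed.

Fact pref_total u : total (pref_rel u).
Proof. by move=> x y; apply: le_total. Qed.

Definition pref (u : utility) : linear_order O :=
  LinearOrder (@pref_refl u) (@pref_anti u) (@pref_trans u) (@pref_total u).

End Utilities.

Definition profile (R : realType) (N O : finType) := {ffun N -> utility R O}.

Definition pref_profile (R : realType) (N O : finType) (u : profile R N O)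
  : N -> linear_order O := fun i => pref (u i).

Section Assignments.
Variables (N O : finType) (q : O -> nat).

Record assignment := Assignment {
  assign :> {ffun N -> O};
  _ : [forall x, #|[set i | assign i == x]| <= q x]%N }.
HB.instance Definition _ := [isSub for assign].
HB.instance Definition _ := [Finite of assignment by <:].

Definition efficient (P : N -> linear_order O) (mu : assignment) : Prop :=
  ~ exists mu' : assignment,
      (forall i, P i (mu' i) (mu i)) /\ exists j, strict (P j) (mu' j) (mu j).

Record distribution (R : realType) := Distribution {
  prob :> assignment -> R;
  prob_ge0 : forall mu, 0 <= prob mu;
  prob_sum1 : \sum_mu prob mu = 1 }.

End Assignments.

Section RuleProperties.
Variables (R : realType) (N O : finType) (q : O -> nat).
Variable f : profile R N O -> distribution N q R.

Definition ex_post_efficient : Prop :=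
  forall (u : profile R N O) (mu : assignment N q),
    0 < f u mu -> efficient (pref_profile u) mu.

Definition equal_treatment_of_equals : Prop :=
  forall (u : profile R N O) (i j : N), u i = u j ->
  forall mu mu' : assignment N q,
    mu i = mu' j -> mu j = mu' i ->
    (forall k, k != i -> k != j -> mu k = mu' k) ->
    f u mu = f u mu'.

Definition probabilistic_monotonicity : Prop :=
  forall (u u' : profile R N O) (mu : assignment N q),
    (forall i, upper (mu i) (pref_profile u' i)
                 \subset upper (mu i) (pref_profile u i)) ->
    f u mu <= f u' mu.

End RuleProperties.

Section RandomPriority.
Variables (N O : finType) (q : O -> nat).

(* (i, j) \in r reads "i comes before j". *)
Definition strict_linear (r : {set N * N}) : bool :=
  [&& [forall i, (i, i) \notin r],
      [forall i, forall j, forall k,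
         ((i, j) \in r) ==> ((j, k) \in r) ==> ((i, k) \in r)]
    & [forall i, forall j, (i != j) ==> ((i, j) \in r) || ((j, i) \in r)]].

Record priority := Priority {
  prio :> {set N * N};
  _ : strict_linear prio }.
HB.instance Definition _ := [isSub for prio].
HB.instance Definition _ := [Finite of priority by <:].

Definition agents_in_order (r : priority) : seq N :=
  sort (fun i j => (i == j) || ((i, j) \in prio r)) (enum N).

(* None marks an agent who has not been served yet. *)
Definition partial_assignment := {ffun N -> option O}.

Definition available (m : partial_assignment) : {set O} :=
  [set x | #|[set i | m i == Some x]| < q x]%N.

Definition best (r : linear_order O) (A : {set O}) : option O :=
  [pick x in A | [forall y in A, r x y]].

Definition serve (P : N -> linear_order O) (m : partial_assignment) (i : N)
  : partial_assignment :=
  [ffun j => if j == i then best (P i) (available m) else m j].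

Definition serial_dictatorship (P : N -> linear_order O) (r : priority)
  : partial_assignment :=
  foldl (serve P) [ffun=> None] (agents_in_order r).

Definition RP (R : realType) (P : N -> linear_order O) (mu : assignment N q)
  : R :=
  (#|N|`!)%:R^-1 *
  \sum_(r : priority)
     (serial_dictatorship P r == [ffun i => Some (mu i)])%:R.

Lemma best_in (r : linear_order O) (A : {set O}) x :
  best r A = Some x -> x \in A.
Proof. by rewrite /best; case: pickP => // y /andP[yA _] [<-]. Qed.

Lemma best_neq_None (r : linear_order O) (A : {set O}) :
  A != set0 -> best r A != None.
Proof.
case/set0Pn => x0 x0A; rewrite /best; case: pickP => // none.
pose up x := #|[set y in A | r x y]|.
have [x xA xmax] := @arg_maxnP O x0 [in A] up x0A; have {}xA : x \in A by [].
have /negP[] := negbT (none x); rewrite xA /=.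
apply/forall_inP => y yA; have [//|nxy] := boolP (r x y).
have ryx : r y x by have := weak_total r x y; rewrite (negPf nxy).
have := xmax y yA; rewrite /= leqNgt => /negP[].
rewrite /up; apply/proper_card/properP; split.
  apply/subsetP => z; rewrite !inE => /andP[-> /=]; exact: weak_trans ryx.
by exists y; rewrite inE yA //=; have := weak_total r y y; rewrite orbb.
Qed.

(* With enough copies, serial dictatorship is an assignment: the case
   best = None never occurs. *)
Lemma serial_dictatorship_total (P : N -> linear_order O) (r : priority) :
  (#|N| <= \sum_x q x)%N ->
  exists mu : assignment N q,
    serial_dictatorship P r = [ffun i => Some (mu i)].
Proof.
move=> capN; set m := serial_dictatorship P r.
have cap (n : partial_assignment) (s : seq N) : uniq s ->
    (forall i, i \in s -> n i = None) ->
    (forall x, #|[set i | n i == Some x]| <= q x)%N ->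
    let n' := foldl (serve P) n s in
    (forall x, #|[set i | n' i == Some x]| <= q x)%N /\
    (forall i, (n i != None) || (i \in s) -> n' i != None).
  elim: s n => [|i s IH] n /=; first by move=> _ _ ?; split=> // i; rewrite orbF.
  case/andP=> iNs us ns nq.
  have nbest : best (P i) (available n) != None.
    apply: best_neq_None; apply/negP => /eqP avail0.
    have full x : #|[set j | n j == Some x]| = q x.
      apply/eqP; rewrite eqn_leq nq leqNgt; apply/negP => lt_x.
      by have := in_set0 x; rewrite -avail0 inE lt_x.
    have : (\sum_x q x < #|N|)%N.
      rewrite -(eq_bigr _ (fun x _ => full x)).
      have -> : (\sum_x #|[set j | n j == Some x]| = #|[set j | n j != None]|)%N.
        rewrite -sum1_card (eq_bigr (fun x => \sum_(j | n j == Some x) 1)%N);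
          last by move=> x _; rewrite -sum1_card; apply: eq_bigl => j; rewrite inE.
        rewrite (exchange_big_dep xpredT) //= big_mkcond [RHS]big_mkcond /=.
        apply: eq_bigr => j _; rewrite inE; case: (n j) => [x|] /=.
          by rewrite (big_pred1 x) // => y; rewrite eq_sym.
        by rewrite big_pred0.
      rewrite -cardsT; apply: proper_card; rewrite properT.
      apply/eqP => /setP/(_ i); rewrite !inE ns ?eqxx //.
      by rewrite inE eqxx.
    by rewrite ltnNge capN.
  have [] := IH (serve P n i) us.
  - move=> j js; rewrite ffunE; case: eqP => [ji|_]; first by rewrite -ji js in iNs.
    by apply: ns; rewrite inE js orbT.
  - move=> x; have [bx|bx] := eqVneq (best (P i) (available n)) (Some x).
      have := best_in bx; rewrite inE; apply: leq_trans.
      rewrite -add1n -(cards1 i); apply: leq_trans (leq_card_setU _ _).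
      apply/subset_leq_card/subsetP => j; rewrite !inE ffunE.
      by case: (j == i).
    apply: leq_trans (nq x); apply/subset_leq_card/subsetP => j.
    by rewrite !inE ffunE; case: (j == i); rewrite ?(negPf bx).
  move=> H1 H2; split=> // j Hj; apply: H2; rewrite ffunE.
  by move: Hj; rewrite inE; case: (j == i) => //=; rewrite nbest.
have [] := cap [ffun=> None] (agents_in_order r).
- by rewrite sort_uniq enum_uniq.
- by move=> i _; rewrite ffunE.
- move=> x; rewrite (_ : [set i | _] = set0) ?cards0 //.
  by apply/setP => i; rewrite !inE ffunE.
rewrite -/(serial_dictatorship P r) -/m => mq mN.
have {}mN i : m i != None by apply: mN; rewrite mem_sort mem_enum orbT.
have [i0 _|N0] := pickP (@predT N); last first.
  have a0 : N -> O by move=> i; have := N0 i.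
  have a0P : [forall x, #|[set i | [ffun i => a0 i] i == x]| <= q x]%N.
    apply/forallP => x; rewrite (_ : [set i | _] = set0) ?cards0 //.
    by apply/setP => i; have := N0 i.
  by exists (Assignment a0P); apply/ffunP => i; have := N0 i.
have x0 : O by case: (m i0) (mN i0).
have mE i : m i = Some (odflt x0 (m i)) by case: (m i) (mN i).
have aP : [forall x, #|[set i | [ffun i => odflt x0 (m i)] i == x]| <= q x]%N.
  apply/forallP => x; apply: leq_trans (mq x).
  apply/subset_leq_card/subsetP => i; rewrite !inE ffunE mE /=.
  by move/eqP=> ->.
by exists (Assignment aP); apply/ffunP => i; rewrite !ffunE.
Qed.

End RandomPriority.

(* Main.v *)
(* Fix two rules satisfying the axioms and let h be their difference. It depends
   on a profile only through the upper contour sets at the assignment, vanishes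
   at inefficient assignments, sums to zero, and is symmetric in agents with
   equal utilities. These four properties force h = 0, by induction on the set L
   of objects that are still "live".
   If h u mu <> 0, efficiency provides a live object z = mu j that nobody envies.
   Moving z to the bottom of L for all agents not holding it changes no upper
   contour set at mu. At most q z agents now rank z higher. An assignment in the
   support of h must give z to each of these: if such an agent gets something
   better than z, then z can be moved down for that agent too, and if it gets
   something worse, it would swap with a holder of z who ranks z last. So these
   agents can be frozen, and all others agree that z is the worst live object.
   By efficiency the number r of them who receive z is then constant. For a fixed
   agent i, the sum of h over assignments giving z to i does not depend on the
   utility of i; making utilities equal one agent at a time and using symmetry,
   this sum is 0. So i can be frozen at z as well, and so on until r = 0. Then z is
   no longer live. *)
From HB Require Import structures.
Require Import Defs.
From mathcomp Require Import all_boot all_order all_algebra all_fingroup reals lra.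

Set Implicit Arguments.
Unset Strict Implicit.
Unset Printing Implicit Defensive.

Import Order.TTheory GRing.Theory Num.Theory.
Local Open Scope ring_scope.

(** * Assignments, upper contour sets and efficiency *)

Section Assignments.
Variables (N O : finType) (q : O -> nat).
Implicit Types (mu : assignment N q) (P : N -> linear_order O).

Lemma assignment_cap mu x : (#|[set i | mu i == x]| <= q x)%N.
Proof. by case: mu => a aP /=; apply: (forallP aP x). Qed.

Lemma assignment_eq mu mu' : (forall i, mu i = mu' i) -> mu = mu'.
Proof. by move=> e; apply/val_inj/ffunP. Qed.

Lemma assignment_of (g : N -> O) :
  (forall x, #|[set i | g i == x]| <= q x)%N ->
  exists mu : assignment N q, forall i, mu i = g i.
Proof.
move=> gq.
have aP : [forall x, #|[set i | [ffun i => g i] i == x]| <= q x]%N.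
  apply/forallP => x; apply: leq_trans (gq x); rewrite subset_leq_card //.
  by apply/subsetP => i; rewrite !inE ffunE.
by exists (Assignment aP) => i; rewrite ffunE.
Qed.

Fact permuted_proof (s : {perm N}) mu :
  [forall x, #|[set i | [ffun i => mu (s i)] i == x]| <= q x]%N.
Proof.
apply/forallP => x; apply: leq_trans (assignment_cap mu x).
rewrite -(card_imset _ (@perm_inj _ s)) subset_leq_card //.
by apply/subsetP => _ /imsetP[i + ->]; rewrite !inE ffunE.
Qed.
Definition permuted s mu := Assignment (permuted_proof s mu).

Lemma permutedE s mu i : permuted s mu i = mu (s i).
Proof. by rewrite ffunE. Qed.

Lemma permuted_tpermK i j : involutive (permuted (tperm i j)).
Proof. by move=> mu; apply: assignment_eq => k; rewrite !permutedE tpermK. Qed.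

Lemma swapP (mu mu' : assignment N q) i j :
    mu i = mu' j -> mu j = mu' i ->
    (forall k, k != i -> k != j -> mu k = mu' k) ->
  mu' = permuted (tperm i j) mu.
Proof.
move=> ij ji other; apply: assignment_eq => k; rewrite permutedE.
by case: tpermP => [->|->|/eqP ki /eqP kj] //; rewrite other.
Qed.

Lemma weakE (r : linear_order O) x y : r x y = (x == y) || (x \in upper y r).
Proof.
rewrite inE /strict; have [<-|xy] := eqVneq; first by rewrite weak_refl.
apply/idP/andP => [rxy|[]//]; split=> //; apply: contra xy => ryx.
by apply/eqP/(@weak_anti _ r)/andP.
Qed.

Lemma upper_irr (r : linear_order O) x : x \notin upper x r.
Proof. by rewrite inE /strict andbN. Qed.

Lemma upper_total (r : linear_order O) x y :
  x != y -> (x \notin upper y r) -> y \in upper x r.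
Proof.
move=> xy xNy; have := weak_total r x y.
by rewrite !weakE (negPf xy) (negPf xNy) /= eq_sym (negPf xy).
Qed.

Lemma efficient_full P mu i y :
  efficient P mu -> y \in upper (mu i) (P i) -> (#|[set j | mu j == y]| = q y)%N.
Proof.
move=> eff yU; apply/eqP; rewrite eqn_leq assignment_cap leqNgt.
apply/negP => lt_y.
have [mu' mu'E] : exists mu' : assignment N q,
    forall j, mu' j = if j == i then y else mu j.
  apply: assignment_of => x; have [->|xy] := eqVneq x y.
    apply: leq_trans lt_y; rewrite -add1n -(cards1 i).
    apply: leq_trans (leq_card_setU _ _); apply/subset_leq_card/subsetP => j.
    by rewrite !inE; case: (j == i).
  apply: leq_trans (assignment_cap mu x); apply/subset_leq_card/subsetP => j.
  by rewrite !inE; case: (j == i); rewrite // eq_sym (negPf xy).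
apply: eff; exists mu'; split=> [j|]; last first.
  by exists i; move: yU; rewrite mu'E eqxx inE.
rewrite mu'E; case: eqP => [->|_]; last exact: weak_refl.
by rewrite weakE yU orbT.
Qed.

(** Every agent moved by [s] gains strictly, so a nontrivial [s] would be a Pareto improvement by
    trade. *)
Lemma efficient_perm P mu (s : {perm N}) i :
    efficient P mu ->
    (forall j, s j = j \/ mu (s j) \in upper (mu j) (P j)) ->
  s i = i.
Proof.
move=> eff better; case: (better i) => // si; case: eff.
exists (permuted s mu); split=> [j|].
  rewrite permutedE weakE; case: (better j) => [->|->]; first by rewrite eqxx.
  by rewrite orbT.
by exists i; rewrite permutedE; move: si; rewrite inE.
Qed.

Lemma efficient_noswap P mu i j :
    efficient P mu -> mu j \in upper (mu i) (P i) ->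
  mu i \notin upper (mu j) (P j).
Proof.
move=> eff iU; apply/negP => jU.
have ji : j = i.
  rewrite -(tpermL i j); apply: efficient_perm eff _ => k.
  by case: tpermP => [->|->|_ _]; [right|right|left].
by move: iU; rewrite ji (negPf (upper_irr _ _)).
Qed.

(* If every agent of S held an object envied by another agent of S, following
   envy inside a minimal invariant set would give a trading cycle. *)
Lemma efficient_unenvied P mu (S : {set N}) i0 :
    efficient P mu -> i0 \in S ->
  exists2 j, j \in S & forall i, i \in S -> mu j \notin upper (mu i) (P i).
Proof.
move=> eff i0S.
have [/exists_inP[j jS /forall_inP jP]|] := boolP
  [exists j in S, [forall i in S, mu j \notin upper (mu i) (P i)]].
  by exists j.
rewrite negb_exists_in => /forall_inP envied.
have envy j : exists i, (j \in S) ==> (i \in S) && (mu j \in upper (mu i) (P i)).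
  have [jS|] := boolP (j \in S); last by exists j.
  have := envied j jS; rewrite negb_forall_in => /exists_inP[i iS /negPn ij].
  by exists i; rewrite iS ij.
pose g j := xchoose (envy j).
have gP j : j \in S -> g j \in S /\ mu j \in upper (mu (g j)) (P (g j)).
  by move=> jS; have /implyP/(_ jS)/andP := xchooseP (envy j).
pose closed A := [&& i0 \in S, A != set0, A \subset S & g @: A \subset A].
have closedS : closed S.
  apply/and4P; split=> //; first by apply/set0Pn; exists i0.
  by apply/subsetP => _ /imsetP[j jS ->]; have [] := gP j jS.
have [A /minsetP[/and4P[_ A0 AS gA] Amin] _] := minset_exists closedS.
have gAA : g @: A = A.
  apply: Amin => //; apply/and4P; split=> //; last exact: imsetS.
    by have /set0Pn[j jA] := A0; apply/set0Pn; exists (g j); apply: imset_f.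
  exact: subset_trans gA AS.
have g_inj : {in A &, injective g}.
  by apply/imset_injP; apply/eqP; rewrite gAA.
(* By minimality [g] permutes [A]; it is extended by the identity outside [A]. *)
pose g' j := if j \in A then g j else j.
have g'_inj : injective g'.
  have gm j : j \in A -> g j \in A by move=> jA; apply: (subsetP gA); apply: imset_f.
  move=> j k; rewrite /g'; case: ifP => jA; case: ifP => kA //.
  - exact: g_inj.
  - by move=> e; rewrite -e gm in kA.
  - by move=> e; rewrite e gm in jA.
(* The inverse is taken because [g j] is the agent who envies [j]: with [s (g j) = j], trading along
   [s] hands [g j] the object it envies. *)
pose s := ((perm g'_inj)^-1)%g.
have sP j : s j = j \/ mu (s j) \in upper (mu j) (P j).
  have -> : j = g' (s j) by rewrite -[RHS](permE g'_inj) permKV.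
  rewrite -{1 3}(permE g'_inj) permK /g'; case: ifP => [sA|]; last by left.
  by right; case: (gP (s j) (subsetP AS _ sA)).
have /set0Pn[j jA] := A0.
have sg : s (g j) = j by rewrite (_ : g j = perm g'_inj j) ?permK // permE /g' jA.
have := efficient_perm (g j) eff sP; rewrite sg => gj.
have [_] := gP j (subsetP AS j jA).
by rewrite -gj (negPf (upper_irr _ _)).
Qed.

End Assignments.

(** * Priority orders and their number *)

Section Priorities.
Variable N : finType.
Implicit Type r : priority N.

Lemma prio_irr r i : (i, i) \notin prio r.
Proof. by case: r => r /=/and3P[/forallP]. Qed.

Lemma prio_trans r i j k :
  (i, j) \in prio r -> (j, k) \in prio r -> (i, k) \in prio r.
Proof.
case: r => r /=/and3P[_ /forallP/(_ i)/forallP/(_ j)/forallP/(_ k) + _].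
by move=> /implyP H ij jk; apply: (implyP (H ij)).
Qed.

Lemma prio_total r i j : i != j -> ((i, j) \in prio r) || ((j, i) \in prio r).
Proof.
by case: r => r /=/and3P[_ _ /forallP/(_ i)/forallP/(_ j)/implyP]; apply.
Qed.

Lemma prio_asym r i j : (i, j) \in prio r -> (j, i) \notin prio r.
Proof.
by move=> ij; apply: contra (prio_irr r i) => /(prio_trans ij).
Qed.

Lemma priority_of (lt : rel N) :
    irreflexive lt -> transitive lt -> (forall i j, i != j -> lt i j || lt j i) ->
  exists r, forall i j, ((i, j) \in prio r) = lt i j.
Proof.
move=> irr tr tot.
have rP : strict_linear [set p | lt p.1 p.2].
  apply/and3P; split; apply/forallP => i; first by rewrite inE irr.
    by apply/forallP => j; apply/forallP => k; rewrite !inE; apply/implyP => ?;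
      apply/implyP; apply: tr.
  by apply/forallP => j; rewrite !inE; apply/implyP/tot.
by exists (Priority rP) => i j; rewrite inE.
Qed.

Lemma priority_eq r r' :
  (forall i j, ((i, j) \in prio r) = ((i, j) \in prio r')) -> r = r'.
Proof. by move=> e; apply/val_inj/setP => -[i j]. Qed.

Lemma prio_first r (A : {set N}) i0 : i0 \in A ->
  exists2 i, i \in A & forall j, j \in A -> (j, i) \notin prio r.
Proof.
move=> i0A; pose below i := #|[set j | (j, i) \in prio r]|.
have [i iA imin] := @arg_minnP N i0 (mem A) below i0A; exists i => // j jA.
apply/negP => ji; have := imin j jA; rewrite leqNgt => /negP; apply.
apply/proper_card/properP; split.
  by apply/subsetP => k; rewrite !inE => /prio_trans; apply.
by exists j; rewrite inE // prio_irr.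
Qed.

Lemma agents_in_order_split r s i s' j :
  agents_in_order r = s ++ i :: s' -> (j \in s) = ((j, i) \in prio r).
Proof.
pose le i j := (i == j) || ((i, j) \in prio r).
have le_trans : transitive le.
  move=> b a c /orP[/eqP->//|ab] /orP[/eqP<-|bc]; rewrite /le ?ab ?orbT //.
  by rewrite (prio_trans ab bc) orbT.
have le_total : total le.
  move=> a b; rewrite /le; have [//|ab] := eqVneq a b.
  exact: prio_total.
rewrite /agents_in_order => es.
have := sort_sorted le_total (enum N); rewrite es sorted_pairwise // => srt.
have := enum_uniq N; rewrite -(sort_uniq le) es.
have : j \in s ++ i :: s' by rewrite -es mem_sort mem_enum.
move: srt; rewrite pairwise_cat => /and3P[/allrelP s_s' _ /andP[/allP i_s' _]].
rewrite mem_cat inE cat_uniq => mem_j /and3P[_ /hasPn nos /andP[is' _]].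
apply/idP/idP => [js|ji].
  have /orP[/eqP ji|//] := s_s' j i js (mem_head _ _).
  by have := nos i (mem_head _ _); rewrite -ji js.
case/or3P: mem_j => // [/eqP ji'|/i_s'/orP[/eqP ji'|ij]].
- by have := prio_irr r i; rewrite -{1}ji' ji.
- by have := prio_irr r i; rewrite {1}ji' ji.
- by have := prio_asym ij; rewrite ji.
Qed.

(** Orders correspond to injections of [N] into the ordinals below [#|N|]: an order is determined by
    the number of predecessors of each agent, and each injection arises from the order it pulls
    back. *)
Lemma card_priority : #|{: priority N}| = #|N|`!.
Proof.
rewrite -ffactnn -{1}[#|N|]card_ord -card_inj_ffuns.
pose pos r i := #|[set j | (j, i) \in prio r]|.
have pos_lt r i j : (i, j) \in prio r -> (pos r i < pos r j)%N.
  move=> ij; apply/proper_card/properP; split.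
    by apply/subsetP => k; rewrite !inE => /prio_trans; apply.
  by exists i; rewrite inE // prio_irr.
have pos_lt_card r i : (pos r i < #|N|)%N.
  rewrite -cardsT; apply/proper_card/properP; split; first exact: subsetT.
  by exists i; rewrite inE // prio_irr.
have posE r i j : ((i, j) \in prio r) = (pos r i < pos r j)%N.
  apply/idP/idP => [/pos_lt//|lt_ij].
  have ij : i != j by apply: contraTneq lt_ij => ->; rewrite ltnn.
  by case/orP: (prio_total r ij) => // /pos_lt; rewrite ltnNge ltnW.
pose rank r := [ffun i => Ordinal (pos_lt_card r i)].
have rank_inj : injective rank.
  move=> r r' e; apply: priority_eq => i j; rewrite !posE.
  by have /ffunP e' := e; have := e' i; have := e' j; rewrite !ffunE => -[->] [->].
rewrite -(card_imset _ rank_inj); apply: eq_card => g; rewrite inE.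
apply/imsetP/injectiveP => [[r _ ->] i j|g_inj].
  rewrite !ffunE => -[e]; apply/eqP; apply: contraT => /(prio_total r).
  by rewrite !posE e ltnn.
have card_lt n m : (m <= n)%N -> #|[set k : 'I_n | (k < m)%N]| = m.
  move=> mn; rewrite -sum1dep_card -(big_ord_widen n (fun=> 1%N) mn).
  by rewrite sum_nat_const card_ord muln1.
have [|||r rE] := @priority_of (fun i j => (g i < g j)%N).
- by move=> i; rewrite ltnn.
- by move=> j i k; apply: ltn_trans.
- by move=> i j ij; rewrite -neq_ltn; apply: contra ij => /eqP/val_inj/g_inj->.
exists r => //; apply/ffunP => i; apply/val_inj; rewrite ffunE /=.
(* By cardinality [g] is a bijection, so it maps the predecessors of [i] onto all indices below
   [g i]. *)
have -> : pos r i = #|[set k : 'I_#|N| | (k < g i)%N]|.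
  rewrite /pos -(card_imset _ g_inj); apply: eq_card => k.
  have [g' _ gK] : bijective g by apply: inj_card_bij; rewrite ?card_ord.
  by rewrite -[k]gK mem_imset // !inE rE.
by rewrite card_lt // ltnW.
Qed.

End Priorities.

(** * Serial dictatorship without the procedure *)

Section SerialDictatorship.
Variables (N O : finType) (q : O -> nat).
Implicit Types (mu : assignment N q) (P : N -> linear_order O).
Implicit Types (r : priority N) (s : seq N).

(** Non-procedural form of the event that serial dictatorship under [r] yields [mu]. Upper contour
    sets enter only as a range of quantification, so shrinking them preserves it; this is the source
    of monotonicity. *)
Definition compatible P r mu :=
  [forall i, forall y in upper (mu i) (P i),
     q y <= #|[set j | (mu j == y) && ((j, i) \in prio r)]|]%N.

Lemma best_SomeP (R : linear_order O) (A : {set O}) x :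
  reflect (x \in A /\ forall y, y \in A -> y \notin upper x R)
          (best R A == Some x).
Proof.
have weakN a b : R a b -> b \notin upper a R.
  by rewrite inE /strict negb_and negbK orbC => ->.
rewrite /best; case: pickP => [y /andP[yA /forall_inP ymax]|none].
  apply: (iffP eqP) => [[<-]|[xA xmax]]; first by split=> // z /ymax/weakN.
  congr Some; apply/eqP; have := xmax y yA; apply: contraNT; rewrite eq_sym => xy.
  exact: upper_total xy (weakN _ _ (ymax x xA)).
apply: (iffP eqP) => // -[xA xmax]; have /negP[] := negbT (none x).
rewrite xA /=; apply/forall_inP => y yA; rewrite weakE.
have [//|xy] := eqVneq x y; apply: upper_total (xmax y yA).
by rewrite eq_sym.
Qed.

Definition served mu s : partial_assignment N O :=
  [ffun i => if i \in s then Some (mu i) else None].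

Lemma best_served P mu s i : i \notin s ->
  (best (P i) (available q (served mu s)) == Some (mu i)) =
  [forall y in upper (mu i) (P i), q y <= #|[set j in s | mu j == y]|]%N.
Proof.
move=> iNs.
have availE y : (y \in available q (served mu s)) =
    (#|[set j in s | mu j == y]| < q y)%N.
  rewrite inE; congr (_ < _)%N; apply: eq_card => j.
  by rewrite !inE ffunE; case: (j \in s).
apply/best_SomeP/forall_inP => [[_ mumax] y|full].
  by move=> yU; rewrite leqNgt -availE; apply: contraTN yU; apply: mumax.
split=> [|y]; last by rewrite availE ltnNge; apply: contra; apply: full.
(* A copy of [mu i] is left because [i], one of its holders in [mu], has not been served. *)
rewrite availE; apply: leq_trans (assignment_cap mu (mu i)).
apply/proper_card/properP; split; first by apply/subsetP => j; rewrite !inE => /andP[].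
by exists i; rewrite !inE // (negPf iNs).
Qed.

Lemma foldl_serve_notin P (m : partial_assignment N O) s i :
  i \notin s -> foldl (serve q P) m s i = m i.
Proof.
elim: s m => //= j s IH m; rewrite inE negb_or => /andP[ij iNs].
by rewrite IH // ffunE (negPf ij).
Qed.

(** The prefix [s1] is general so that the induction can move agents into it one at a time. No agent
    occurs twice, so no entry is overwritten and the final state reveals every choice. *)
Lemma foldl_serveP P mu s1 s2 : uniq (s1 ++ s2) ->
  foldl (serve q P) (served mu s1) s2 = served mu (s1 ++ s2) <->
  forall t1 i t2, s2 = t1 ++ i :: t2 ->
    best (P i) (available q (served mu (s1 ++ t1))) == Some (mu i).
Proof.
elim: s2 s1 => [|i s2 IH] s1 us; first by rewrite cats0; split=> // _ [].
have serve_i : best (P i) (available q (served mu s1)) = Some (mu i) ->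
    serve q P (served mu s1) i = served mu (rcons s1 i).
  move=> bi; apply/ffunP => j; rewrite !ffunE mem_rcons inE.
  by have [->|//] := eqVneq j i.
have us' : uniq (rcons s1 i ++ s2) by rewrite cat_rcons.
split=> [/= e|H].
  have bi : best (P i) (available q (served mu s1)) = Some (mu i).
    have /ffunP/(_ i) := e; rewrite foldl_serve_notin.
      by rewrite !ffunE eqxx mem_cat mem_head orbT.
    by move: us; rewrite cat_uniq => /and3P[_ _ /= /andP[]].
  move=> [|j t1] k t2 /= [<- es]; first by rewrite cats0 bi.
  move: e; rewrite serve_i // -cat_rcons => /(IH _ us')/(_ t1 k t2 es).
  by rewrite cat_rcons.
rewrite /= serve_i; last by apply/eqP; have := H [::] i s2 erefl; rewrite cats0.
rewrite -cat_rcons; apply/(IH _ us') => t1 k t2 es.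
by rewrite cat_rcons; apply: (H (i :: t1) k t2); rewrite es.
Qed.

Lemma serial_dictatorshipE P r mu :
  (serial_dictatorship q P r == [ffun i => Some (mu i)]) = compatible P r mu.
Proof.
have us : uniq ([::] ++ agents_in_order r) by rewrite sort_uniq enum_uniq.
have -> : [ffun i => Some (mu i)] = served mu ([::] ++ agents_in_order r).
  by apply/ffunP => i; rewrite !ffunE mem_sort mem_enum.
rewrite /serial_dictatorship.
have -> : [ffun=> None] = served mu [::] by apply/ffunP => i; rewrite !ffunE.
have stepE t1 i t2 : agents_in_order r = t1 ++ i :: t2 ->
    (best (P i) (available q (served mu t1)) == Some (mu i)) =
    [forall y in upper (mu i) (P i),
       q y <= #|[set j | (mu j == y) && ((j, i) \in prio r)]|]%N.
  move=> es; rewrite best_served; last first.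
    by rewrite (agents_in_order_split _ es) prio_irr.
  apply: eq_forallb_in => y _; congr (_ <= _)%N; apply: eq_card => j.
  by rewrite !inE (agents_in_order_split _ es) andbC.
apply/eqP/forallP => [/(foldl_serveP P mu us) H i|H].
  have [t1 [t2 es]] : exists t1 t2, agents_in_order r = t1 ++ i :: t2.
    have : i \in agents_in_order r by rewrite mem_sort mem_enum.
    by case/path.splitPr=> t1 t2; exists t1, t2.
  by rewrite -(stepE t1 i t2) //; apply: H es.
by apply/(foldl_serveP P mu us) => t1 i t2 es; rewrite (stepE _ _ _ es); apply: H.
Qed.

Lemma compatible_subset P P' r mu :
    (forall i, upper (mu i) (P' i) \subset upper (mu i) (P i)) ->
  compatible P r mu -> compatible P' r mu.
Proof.
move=> sub /forallP comp; apply/forallP => i; apply/forall_inP => y yU.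
by apply: (forall_inP (comp i)); apply: (subsetP (sub i)).
Qed.

Lemma compatible_efficient P r mu : compatible P r mu -> efficient P mu.
Proof.
move=> /forallP comp [mu' [wk [j st]]].
have jD : j \in [set i | mu' i != mu i].
  by rewrite inE; apply: contraTneq st => ->; rewrite /strict andbN.
(* Take the first agent [i] whose object changes. Its new object was exhausted in [mu] by
   predecessors, who all keep it in [mu']; adding [i] exceeds the capacity. *)
have [i + imin] := prio_first r jD; rewrite inE => imu.
have iU : mu' i \in upper (mu i) (P i) by have := wk i; rewrite weakE (negPf imu).
have /forall_inP/(_ _ iU) := comp i; rewrite leqNgt => /negP; apply.
apply: leq_trans (assignment_cap mu' (mu' i)); apply/proper_card/properP; split.
  apply/subsetP => k; rewrite !inE => /andP[/eqP <- ki].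
  by apply: contraLR ki => kmu; apply: imin; rewrite inE.
by exists i; rewrite !inE ?eqxx // negb_and prio_irr orbT.
Qed.

Fact relabel_proof (s : {perm N}) r :
  strict_linear [set p | (s p.1, s p.2) \in prio r].
Proof.
apply/and3P; split; apply/forallP => i; first by rewrite inE prio_irr.
  apply/forallP => j; apply/forallP => k; rewrite !inE; apply/implyP => ij.
  by apply/implyP; apply: prio_trans ij.
apply/forallP => j; rewrite !inE; apply/implyP => ij.
by apply: prio_total; rewrite (inj_eq perm_inj).
Qed.
Definition relabel (s : {perm N}) r := Priority (relabel_proof s r).

Lemma relabel_tpermK i j : involutive (relabel (tperm i j)).
Proof. by move=> r; apply: priority_eq => a b; rewrite !inE /= !tpermK. Qed.

(** Relabelling agents in the order and in the assignment alike preserves all counts of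
    predecessors. For a transposition of equals this pairs the orders yielding [mu] with those
    yielding its swap. *)
Lemma compatible_relabel P (s : {perm N}) r mu : (forall i, P (s i) = P i) ->
  compatible P (relabel s r) (permuted s mu) = compatible P r mu.
Proof.
move=> Ps; have full i y : #|[set j | (permuted s mu j == y) &&
      ((j, i) \in prio (relabel s r))]| =
    #|[set j | (mu j == y) && ((j, s i) \in prio r)]|.
  rewrite -[RHS](card_preimset _ (@perm_inj _ s)); apply: eq_card => j.
  by rewrite !inE /= ffunE.
apply/forallP/forallP => comp i; apply/forall_inP => y yU.
  rewrite -[i](permKV s) -full; move/forall_inP: (comp ((s^-1)%g i)); apply.
  by rewrite permutedE permKV -(permKV s i) Ps permKV in yU *.
rewrite full; move/forall_inP: (comp (s i)); apply.
by rewrite Ps -permutedE.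
Qed.

(** * The axioms for Random Priority *)

Variable R : realType.

Lemma RP_compatible P mu :
  RP R P mu = (#|N|`!)%:R^-1 * \sum_(r : priority N) (compatible P r mu)%:R.
Proof. by congr (_ * _); apply: eq_bigr => r _; rewrite serial_dictatorshipE. Qed.

Lemma RP_ge0 P mu : 0 <= RP R P mu.
Proof.
rewrite RP_compatible mulr_ge0 ?invr_ge0 ?ler0n //.
by apply: sumr_ge0 => r _; rewrite ler0n.
Qed.

Lemma RP_monotone P P' mu :
    (forall i, upper (mu i) (P' i) \subset upper (mu i) (P i)) ->
  RP R P mu <= RP R P' mu.
Proof.
move=> sub; rewrite !RP_compatible ler_wpM2l ?invr_ge0 ?ler0n //.
apply: ler_sum => r _; rewrite ler_nat.
by case: (boolP (compatible P r mu)) => // /(compatible_subset sub) ->.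
Qed.

Lemma RP_efficient P mu : 0 < RP R P mu -> efficient P mu.
Proof.
rewrite RP_compatible => RP_gt0.
have [r comp|none] := pickP (fun r => compatible P r mu).
  exact: compatible_efficient comp.
by move: RP_gt0; rewrite big1 ?mulr0 ?ltxx // => r _; rewrite none.
Qed.

Lemma RP_swap P i j mu : P i = P j ->
  RP R P (permuted (tperm i j) mu) = RP R P mu.
Proof.
move=> Pij; rewrite !RP_compatible; congr (_ * _).
rewrite (reindex_inj (inv_inj (relabel_tpermK i j))) /=.
apply: eq_bigr => r _; rewrite compatible_relabel // => k.
by case: tpermP => [->|->|].
Qed.

(** After exchanging the sums, each order contributes 1, since capacity makes its outcome exactly
    one assignment. *)
Lemma RP_sum1 P : (#|N| <= \sum_x q x)%N ->
  \sum_(mu : assignment N q) RP R P mu = 1.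
Proof.
move=> cap; rewrite -mulr_sumr exchange_big /=.
rewrite (eq_bigr (fun=> 1)) => [|r _]; last first.
  have [mu0 e] := serial_dictatorship_total P r cap.
  rewrite (bigD1 mu0) //= e eqxx big1 ?addr0 // => mu ne.
  case: eqP => // /ffunP e'; case/negP: ne; apply/eqP/assignment_eq => i.
  by have := e' i; rewrite !ffunE => -[].
by rewrite sumr_const card_priority mulVf // pnatr_eq0 -lt0n fact_gt0.
Qed.

End SerialDictatorship.

(** * Demotion of objects, symmetry, and residuals *)

Section Residual.
Variables (R : realType) (N O : finType) (q : O -> nat).
Implicit Types (u w : profile R N O) (mu : assignment N q) (v : utility R O).
Implicit Types (S : {set N}) (L : {set O}) (D : profile R N O -> Prop).
Implicit Types (B : O -> {set O}).
Implicit Types (h : profile R N O -> assignment N q -> R).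

Lemma in_upper v x y : (y \in upper x (pref v)) = (v x < v y).
Proof. by rewrite inE /strict /= /pref_rel -ltNge andb_idl // => /ltW. Qed.

Lemma utility_inj v : injective v.
Proof. by case: v => v /= /injectiveP. Qed.

(** Moves [z] to the bottom of [L] within a utility function. A live object ranked above [z] keeps
    its upper contour set because [z] stays below it. *)
Lemma demote L z v :
    z \in L -> (forall x y, x \in L -> y \notin L -> v y < v x) ->
  exists v', [/\ forall x, x \in L -> z \notin upper x (pref v) -> x != z ->
                   upper x (pref v') = upper x (pref v),
                 forall y, y \notin L -> upper y (pref v') = upper y (pref v)
               & upper z (pref v') = L :\ z].
Proof.
(* [M] exceeds every absolute value of [v]: dead objects stay below [M], live ones other than [z]
   are lifted above [3 * M], and [z] is placed between them at [2 * M]. *)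
move=> zL Lv; pose M := 1 + \sum_x `|v x|.
have vM x : `|v x| < M.
  rewrite /M (bigD1 x) //= addrCA ltrDl ltr_pwDl ?ltr01 //.
  by apply: sumr_ge0 => y _; apply: normr_ge0.
have M0 : 0 < M by apply: le_lt_trans (vM z).
have lo x : - M < v x by have := vM x; rewrite ltr_norml => /andP[].
have hi x : v x < M by have := vM x; rewrite ltr_norml => /andP[].
pose w := [ffun x => if x == z then 2 * M else if x \in L then v x + 4 * M else v x].
have wz : w z = 2 * M by rewrite ffunE eqxx.
have wL x : x \in L -> x != z -> w x = v x + 4 * M.
  by move=> xL xz; rewrite ffunE (negPf xz) xL.
have wD x : x \notin L -> w x = v x.
  by move=> xL; rewrite ffunE (negPf xL); case: eqP xL => // ->; rewrite zL.
have w_hi x : x \in L -> x != z -> 2 * M < w x.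
  by move=> xL xz; rewrite wL //; have := lo x; lra.
have w_lo x : x \notin L -> w x < 2 * M.
  by move=> xL; rewrite wD //; have := hi x; lra.
have w_ltE x y : x != z -> y != z -> (w x < w y) = (v x < v y).
  move=> xz yz; have [xL|xL] := boolP (x \in L); have [yL|yL] := boolP (y \in L).
  - by rewrite !wL // ltrD2r.
  - rewrite ltNge (ltW (lt_trans (w_lo y yL) (w_hi x xL xz))).
    by rewrite ltNge (ltW (Lv x y xL yL)).
  - by rewrite (lt_trans (w_lo x xL) (w_hi y yL yz)) Lv.
  - by rewrite !wD.
have w_inj : injectiveb w.
  apply/injectiveP => x y e.
  have zE a : w a = w z -> a = z.
    rewrite wz => wa; apply/eqP; apply: contraT => az.
    have [aL|aL] := boolP (a \in L).
      by have := w_hi a aL az; rewrite wa ltxx.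
    by have := w_lo a aL; rewrite wa ltxx.
  have [xz|xz] := eqVneq x z; first by rewrite xz; apply/esym/zE; rewrite -e xz.
  have [yz|yz] := eqVneq y z; first by rewrite yz; apply: zE; rewrite e yz.
  apply: (@utility_inj v); apply/eqP; rewrite eq_le !leNgt -!w_ltE //.
  by rewrite e ltxx.
exists (Utility w_inj); split=> [x xL zNx xz|y yL|].
- apply/setP => y; rewrite !in_upper /=; have [->|yz] := eqVneq y z.
    move: zNx; rewrite in_upper => /negPf ->; rewrite wz.
    by rewrite ltNge ltW // w_hi.
  by rewrite w_ltE.
- have yz : y != z by apply: contraNneq yL => ->.
  apply/setP => x; rewrite !in_upper /=; have [->|xz] := eqVneq x z.
    by rewrite wz w_lo // Lv.
  by rewrite w_ltE.
apply/setP => x; rewrite in_upper inE in_set1 /= wz.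
have [->|xz] := eqVneq x z; first by rewrite wz ltxx.
have [xL|xL] := boolP (x \in L); first by rewrite w_hi.
by rewrite ltNge ltW // w_lo.
Qed.

Definition update u i v : profile R N O := [ffun j => if j == i then v else u j].

HB.instance Definition _ := [Equality of utility R O by <:].

(* Replacing u i by the fixed utility v leaves d i unchanged and increases the
   number of agents of S with utility v; all of these share one value of d, and
   the other values vanish by induction. *)
Lemma symmetric_zero D S (d : N -> profile R N O -> R) :
    (forall u u' i j, D u -> D u' -> i \in S -> j \in S -> D (update u i (u' j))) ->
    (forall u i v, D u -> D (update u i v) -> i \in S -> d i (update u i v) = d i u) ->
    (forall u, D u -> \sum_(i in S) d i u = 0) ->
    (forall u i j, D u -> i \in S -> j \in S -> u i = u j -> d i u = d j u) ->
  forall u i, D u -> i \in S -> d i u = 0.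
Proof.
move=> D_upd d_own d_sum d_sym u0 i0 Du0 i0S; pose v := u0 i0.
(* The count leaves out [i] itself. Passing from [i] to an agent [j] with [u' j != v] then removes
   [j] from the count and adds nobody, since [i] now has utility [v]. *)
suff main k u i : D u -> i \in S ->
    (#|[set j in S | (u j != v) && (j != i)]| <= k)%N -> d i u = 0.
  exact: main Du0 i0S (leqnn _).
elim/ltn_ind: k u i => k IH u i Du iS ltk.
pose u' := update u i v; have Du' : D u' by apply: D_upd.
have u'i : u' i = v by rewrite ffunE eqxx.
rewrite -(d_own u i v) // -/u'.
have other j : j \in S -> u' j != v -> d j u' = 0.
  move=> jS jv; apply: (IH _ _ u' j Du' jS (leqnn _)).
  apply: leq_trans ltk; apply/proper_card/properP; split.
    apply/subsetP => l; rewrite !inE ffunE.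
    by have [_|_ /and3P[-> -> _]] := eqVneq l i; rewrite ?eqxx ?andbF.
  have ji : j != i by apply: contraNneq jv => ->; rewrite u'i.
  by exists j; rewrite !inE ?eqxx ?andbF // jS ji andbT; move: jv; rewrite ffunE (negPf ji).
have := d_sum u' Du'; rewrite (bigID (fun j => u' j == v)) /= [X in _ + X]big1.
  rewrite addr0 (eq_bigr (fun=> d i u')) => [|j /andP[jS /eqP jv]]; last first.
    by apply: d_sym => //; rewrite jv u'i.
  rewrite sumr_const => /eqP; rewrite mulrn_eq0 => /orP[|/eqP //].
  by move=> /eqP/card0_eq/(_ i); rewrite unfold_in /= iS u'i eqxx.
by move=> j /andP[jS jv]; apply: other.
Qed.

(** The properties of a difference of two rules that survive freezing. Symmetry is asked only inside
    [S], because restricting [h] to assignments that give a fixed object to a frozen agent destroys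
    it for that agent. *)
Record residual D S h : Prop := Residual {
  residual_efficient : forall u mu,
    D u -> h u mu != 0 -> efficient (pref_profile u) mu;
  residual_upper : forall u u' mu, D u -> D u' ->
    (forall i, upper (mu i) (pref (u i)) = upper (mu i) (pref (u' i))) ->
    h u mu = h u' mu;
  residual_sum : forall u, D u -> \sum_mu h u mu = 0;
  residual_swap : forall u i j mu, D u -> i \in S -> j \in S -> u i = u j ->
    h u (permuted (tperm i j) mu) = h u mu }.

Lemma residual_sub D D' S S' h :
    (forall u, D' u -> D u) -> S' \subset S -> residual D S h -> residual D' S' h.
Proof.
move=> DD' /subsetP SS' [eff upp sum swap]; split.
- by move=> u mu /DD'; apply: eff.
- by move=> u u' mu /DD' Du /DD' Du'; apply: upp.
- by move=> u /DD'; apply: sum.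
- by move=> u i j mu /DD' Du /SS' iS /SS' jS; apply: swap.
Qed.

(* Agents outside S are frozen at their utility in u0. For the others, the dead
   objects (those outside L) have the prescribed upper contour sets B, so that
   live objects are ranked above dead ones once L is included in each B y. *)
Definition settled S L B u0 u : Prop :=
  (forall i, i \notin S -> u i = u0 i) /\
  (forall i y, i \in S -> y \notin L -> upper y (pref (u i)) = B y).

Definition supported D S L (x0 : N -> O) h : Prop :=
  forall u mu, D u -> h u mu != 0 ->
    (forall i, i \in S -> mu i \in L) /\ (forall i, i \notin S -> mu i = x0 i).

(** Quantifying over [S], [u0], [x0] and [h] lets the inductions pass to fewer free agents and to
    restrictions of [h]. *)
Definition vanishing L B : Prop :=
  forall S u0 (x0 : N -> O) h,
    residual (settled S L B u0) S h -> supported (settled S L B u0) S L x0 h ->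
    (forall i, i \notin S -> x0 i \notin L) ->
  forall u mu, settled S L B u0 u -> h u mu = 0.

Lemma settled_update S L B u0 u u' i j :
    settled S L B u0 u -> settled S L B u0 u' -> i \in S -> j \in S ->
  settled S L B u0 (update u i (u' j)).
Proof.
move=> [u_off u_in] [_ u'_in] iS jS; split=> [k kS|k y kS yL]; rewrite ffunE.
  by case: eqP kS => [->|_ /u_off //]; rewrite iS.
by case: eqP => _; [apply: u'_in|apply: u_in].
Qed.

(** * Elimination of a live object *)

Lemma sum_card_fibers (A : {set O}) mu :
  (\sum_(x in A) #|[set i | mu i == x]| = #|[set i | mu i \in A]|)%N.
Proof.
rewrite -sum1_card (partition_big mu (mem A)) => [|i]; last by rewrite inE.
apply: eq_bigr => x xA; rewrite -sum1_card; apply: eq_bigl => i.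
by rewrite !inE; case: eqP => [->|]; rewrite ?andbF ?andbT // -[x \in _]/(x \in A) xA.
Qed.

(** If some agent of [S] gets [z], it prefers all of [L], so efficiency exhausts [L] and the rest of
    [S] get [z]. If none does, the capacity of [L] covers [S] and the truncated subtraction gives
    0. *)
Lemma card_last S L z u mu :
    z \notin L -> (forall i, i \in S -> mu i \in z |: L) ->
    (forall i, i \notin S -> mu i \notin L) ->
    (forall i, i \in S -> upper z (pref (u i)) = L) ->
    efficient (pref_profile u) mu ->
  #|[set i in S | mu i == z]| = (#|S| - \sum_(x in L) q x)%N.
Proof.
move=> zL muS mu_off Sz eff.
have -> : #|S| = (#|[set i in S | mu i == z]| + #|[set i | mu i \in L]|)%N.
  have disj : [set i in S | mu i == z] :&: [set i | mu i \in L] = set0.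
    apply/setP => i; rewrite !inE -andbA; case: eqP => [->|_]; last by rewrite andbF.
    by rewrite (negPf zL) !andbF.
  rewrite -[RHS]subn0 -(cards0 N) -disj -cardsU; apply: eq_card => i; rewrite !inE.
  have [iS|iS] := boolP (i \in S); last by rewrite (negPf (mu_off i iS)).
  by have := muS i iS; rewrite !inE => ->.
rewrite -sum_card_fibers.
have [->|[i]] := set_0Vmem [set i in S | mu i == z].
  rewrite cards0 add0n; apply/esym/eqP; rewrite subn_eq0.
  by apply: leq_sum => x _; apply: assignment_cap.
rewrite inE => /andP[iS /eqP muz].
rewrite (eq_bigr q) ?addnK // => x xL; apply: (efficient_full (i := i) eff).
by rewrite muz Sz.
Qed.

(** Here [z] is already dead in [settled] but free agents may still receive it. Induction on [#|S|]
    freezes its recipients one by one, until the support lies in [L] and [van] applies. *)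
Lemma vanishing_last L B z : z \notin L -> B z = L -> vanishing L B ->
  forall S u0 (x0 : N -> O) h,
    residual (settled S L B u0) S h -> supported (settled S L B u0) S (z |: L) x0 h ->
    (forall i, i \notin S -> x0 i \notin L) ->
  forall u mu, settled S L B u0 u -> h u mu = 0.
Proof.
move=> zL Bz van S; have [n] := ubnP #|S|.
elim: n S => // n IH S ltSn u0 x0 h res supp x0L u mu Du.
have [eff upp sum swap] := res.
pose r := (#|S| - \sum_(x in L) q x)%N.
have card_z w nu : settled S L B u0 w -> h w nu != 0 ->
    #|[set i in S | nu i == z]| = r.
  move=> Dw nz; have [nuS nu_off] := supp w nu Dw nz.
  apply: (card_last (u := w)) => // [i iS|i iS|]; last exact: eff nz.
    by rewrite nu_off // x0L.
  by case: Dw => _ ->.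
have [r0|r_gt0] := posnP r.
  apply: (van S u0 x0 h) => // w nu Dw nz.
  have [nuS nu_off] := supp w nu Dw nz; split=> // i iS.
  have := card_z w nu Dw nz; rewrite r0 => /eqP; rewrite cards_eq0.
  move=> /eqP/setP/(_ i); rewrite !inE iS /= => nuz.
  by have := nuS i iS; rewrite !inE nuz.
pose d i w := \sum_(nu : assignment N q | nu i == z) h w nu.
(* [symmetric_zero] applies: the upper contour set at [z] of a free agent is always [B z], so its
   own utility does not affect [d i]; and each assignment in the support is counted [r] times, so
   the [d i] add up to [r] times the zero sum of [h]. *)
have d0 w i : settled S L B u0 w -> i \in S -> d i w = 0.
  apply: symmetric_zero => {w i} [w w' i j|w i v Dw Dw' iS|w Dw|w i j Dw iS jS wij].
  - exact: settled_update.
  - apply: eq_bigr => nu /eqP nuz; apply: upp => // j; rewrite ffunE.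
    case: eqP => // ->; rewrite nuz.
    have [_ w_in] := Dw; have [_ w'_in] := Dw'.
    by rewrite w_in // -(w'_in i) // ffunE eqxx.
  - rewrite (exchange_big_dep predT) //= (eq_bigr (fun nu => h w nu *+ r)) => [|nu _].
      by rewrite sumrMnl sum // mul0rn.
    have [->|nz] := eqVneq (h w nu) 0; first by rewrite big1 ?mul0rn.
    rewrite sumr_const -(card_z w nu Dw nz); congr (_ *+ _).
    by apply: eq_card => i; rewrite !inE.
  rewrite /d (reindex_inj (inv_inj (@permuted_tpermK _ _ _ i j))) /=.
  apply: eq_big => [nu|nu _]; last exact: swap.
  by rewrite permutedE tpermL.
apply/eqP; apply: contraT => nz.
have := card_z u mu Du nz; have [->|[i]] := set_0Vmem [set i in S | mu i == z].
  by move=> r0; rewrite -r0 cards0 in r_gt0.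
rewrite inE => /andP[iS muz] _.
(* With [i] frozen at [z], this restriction is again a residual; its zero sum is [d0]. *)
pose h' w (nu : assignment N q) := if nu i == z then h w nu else 0.
have D'D w : settled (S :\ i) L B u w -> settled S L B u0 w.
  have [u_off u_in] := Du; move=> [w_off w_in]; split=> [k kS|k y kS yL].
    by rewrite w_off ?u_off // !inE (negPf kS) andbF.
  have [->|ki] := eqVneq k i; first by rewrite w_off ?u_in // !inE eqxx.
  by apply: w_in; rewrite // !inE ki.
suff : h' u mu = 0 by rewrite /h' muz => /eqP; rewrite (negPf nz).
apply: (IH (S :\ i) _ u (fun k => if k == i then z else x0 k)).
- by rewrite [#|S|](cardsD1 i) iS in ltSn.
- split.
  + by move=> w nu /D'D Dw; rewrite /h'; case: ifP => [_ /(eff _ _ Dw)|]; rewrite ?eqxx.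
  + by move=> w w' nu /D'D Dw /D'D Dw' e; rewrite /h'; case: ifP => // _; apply: upp.
  + by move=> w /D'D Dw; rewrite /h' -big_mkcond; apply: d0.
  move=> w j k nu /D'D Dw; rewrite !inE => /andP[ji jS] /andP[ki kS] wjk.
  rewrite /h' permutedE tpermD // ?(eq_sym _ i) //.
  by case: ifP => // _; apply: swap.
- move=> w nu /D'D Dw; rewrite /h'; case: ifP => [/eqP nuz nz'|]; last by rewrite eqxx.
  have [nuS nu_off] := supp w nu Dw nz'.
  split=> k; first by rewrite inE => /andP[_]; apply: nuS.
  by rewrite !inE negb_and negbK; case: eqP => [->|_ /nu_off].
- move=> k; rewrite !inE negb_and negbK; case: eqP => //= _; exact: x0L.
- by split=> [k|k y /setD1P[_ kS] yL] //; have [_ ->] := Du.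
Qed.

(** Induction on the number of free agents who rank [z] above another live object. Once all of them
    are shown to receive [z], they are frozen and [vanishing_last] handles the others. *)
Lemma vanishing_few_above L B z S u0 x0 h :
    z \in L -> (forall y, y \notin L -> L \subset B y) ->
    vanishing (L :\ z) (fun y => if y == z then L :\ z else B y) ->
    residual (settled S L B u0) S h -> supported (settled S L B u0) S L x0 h ->
    (forall i, i \notin S -> x0 i \notin L) ->
  forall u mu, settled S L B u0 u ->
    (#|[set i in S | upper z (pref (u i)) != L :\ z]| <= q z)%N -> h u mu = 0.
Proof.
move=> zL LB van res supp x0L u; have [eff upp sum swap] := res.
pose above w := [set i in S | upper z (pref (w i)) != L :\ z].
have [n] := ubnP #|above u|; elim: n u => // n IH u lt_n mu Du few.
pose B' y := if y == z then L :\ z else B y.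
(* Freezing [above u] and keeping [z] last in [L] for the other free agents makes [above] constant
   on the new domain. *)
have D'D w : settled (S :\: above u) (L :\ z) B' u w ->
    settled S L B u0 w /\ above w = above u.
  have [u_off u_in] := Du; move=> [w_off w_in]; split.
    split=> [k kS|k y kS yL]; first by rewrite w_off ?u_off // inE (negPf kS) andbF.
    have [ka|ka] := boolP (k \in above u).
      by rewrite w_off ?u_in // inE ka.
    rewrite w_in ?in_setD ?in_setD1 ?ka ?(negPf yL) ?andbF // /B'.
    by case: eqP yL => // ->; rewrite zL.
  apply/setP => k; have [ka|ka] := boolP (k \in above u).
    by rewrite -[RHS]ka !inE w_off // inE ka.
  rewrite inE; have [kS /=|//] := boolP (k \in S).
  have kSa : k \in S :\: above u by rewrite in_setD ka kS.
  by rewrite w_in ?in_setD1 ?eqxx // /B' !eqxx.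
apply: (vanishing_last (z := z) _ _ van (S := S :\: above u) (u0 := u)
  (x0 := fun k => if k \in above u then z else x0 k) (h := h)).
- by rewrite !inE eqxx.
- by rewrite eqxx.
- by apply: residual_sub res => [w /D'D[]|]; rewrite ?subsetDl.
- move=> w nu /D'D[Dw aw] nz; have [nuS nu_off] := supp w nu Dw nz.
  have eff_nu := eff _ _ Dw nz.
  have above_z i : i \in above u -> nu i = z.
    move=> ia; have := ia; rewrite -aw inE => /andP[iS upz].
    apply/eqP; apply: contraT => nuz.
    have [zU|zNU] := boolP (z \in upper (nu i) (pref (w i))).
      have full := efficient_full eff_nu zU.
      (* All [q z] copies are taken, none by [i], and [above u] has at most [q z] members including
         [i]. So some holder [j] of [z] lies outside [above u], ranks [z] last in [L], and would
         swap with [i]. *)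
      have [sub|/subsetPn[j]] := boolP ([set j | nu j == z] \subset above u).
        suff : (#|[set j | nu j == z]| < #|above u|)%N by rewrite full ltnNge few.
        by apply/proper_card/properP; split=> //; exists i; rewrite // inE.
      rewrite inE => /eqP nuj ja.
      have jS : j \in S.
        by apply: contraT => jS; have := x0L j jS; rewrite -nu_off // nuj zL.
      have := @efficient_noswap _ _ _ _ nu i j eff_nu.
      rewrite nuj => /(_ zU); rewrite /pref_profile.
      move: ja; rewrite -aw inE jS negbK => /eqP ->.
      by rewrite in_setD1 nuz nuS.
    (* Now [i] prefers [nu i] to [z]. Demoting [z] for [i] preserves the value of [h] at [nu] and
       shrinks [above], so by induction this value is 0. *)
    have Lw x y : x \in L -> y \notin L -> w i y < w i x.
      move=> xL yL; rewrite -in_upper; have [_ ->] := Dw => //.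
      exact: (subsetP (LB y yL)).
    have [v [v_up v_dead vz]] := demote zL Lw.
    pose w' := update w i v.
    have Dw' : settled S L B u0 w'.
      have [w_off w_in] := Dw; split=> [k kS|k y kS yL]; rewrite ffunE.
        by case: eqP kS => [->|_ /w_off //]; rewrite iS.
      by have [_|_] := eqVneq k i; [rewrite v_dead ?w_in|apply: w_in].
    have lt_above : (#|above w'| < #|above u|)%N.
      rewrite -aw; apply/proper_card/properP; split.
        apply/subsetP => k; rewrite !inE ffunE.
        by have [->|//] := eqVneq k i; rewrite vz eqxx andbF.
      by exists i; rewrite ?aw // inE ffunE eqxx vz eqxx andbF.
    case/eqP: nz; rewrite (upp w w') //.
      by apply: IH => //; [apply: leq_trans lt_above _|apply: leq_trans (ltnW lt_above) few].
    move=> k; rewrite ffunE; have [->|//] := eqVneq k i.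
    by rewrite v_up // nuS.
  split=> k.
    rewrite inE => /andP[ka kS]; rewrite setD1K //; exact: nuS.
  rewrite inE negb_and negbK; have [ka _|ka /= kS] := boolP (k \in above u).
    by rewrite above_z.
  exact: nu_off.
- move=> k; rewrite in_setD negb_and negbK in_setD1.
  have [_ _|_ /= kS] := boolP (k \in above u); first by rewrite eqxx.
  by rewrite (negPf (x0L k kS)) andbF.
split=> // k y; rewrite inE => /andP[ka kS]; rewrite inE negb_and negbK inE.
case: eqVneq => [-> _|_ /= yL]; first by move: ka; rewrite inE kS negbK => /eqP.
by have [_ ->] := Du.
Qed.

Lemma vanishing_settled L B : (forall y, y \notin L -> L \subset B y) -> vanishing L B.
Proof.
have [n] := ubnP #|L|; elim: n L B => // n IH L B lt_n LB S u0 x0 h res supp x0L u mu Du.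
have [eff upp sum swap] := res.
apply/eqP; apply: contraT => nz; have [muS mu_off] := supp u mu Du nz.
(* With everyone frozen, [mu] is the only assignment in the support, and the zero sum gives the
   claim. *)
have [S0|[i0 i0S]] := set_0Vmem S.
  have := sum u Du; rewrite (bigD1 mu) //= big1 ?addr0 => [/eqP|nu ne].
    by rewrite (negPf nz).
  apply/eqP; apply: contraT => nz'; have [_ nu_off] := supp u nu Du nz'.
  by case/eqP: ne; apply: assignment_eq => i; rewrite nu_off ?mu_off // S0 inE.
have [j jS unenvied] := efficient_unenvied (eff _ _ Du nz) i0S.
have zL : mu j \in L by apply: muS.
set z := mu j in zL unenvied.
have demoted i : exists v, i \in S -> mu i != z ->
    [/\ upper (mu i) (pref v) = upper (mu i) (pref (u i)),
        forall y, y \notin L -> upper y (pref v) = B y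
      & upper z (pref v) = L :\ z].
  have [iS|_] := boolP (i \in S); last by exists (u i).
  have [_|muz] := eqVneq (mu i) z; first by exists (u i).
  have u_in y : y \notin L -> upper y (pref (u i)) = B y by have [_] := Du; apply.
  have Lu x y : x \in L -> y \notin L -> u i y < u i x.
    by move=> xL yL; rewrite -in_upper u_in // (subsetP (LB y yL)).
  have [v [v_up v_dead vz]] := demote zL Lu; exists v => _ _; split=> //.
    by rewrite v_up ?unenvied ?muS.
  by move=> y yL; rewrite v_dead ?u_in.
have [v vP] := fin_all_exists demoted.
pose u' : profile R N O := [ffun i => if (i \in S) && (mu i != z) then v i else u i].
have Du' : settled S L B u0 u'.
  have [u_off u_in] := Du; split=> [i iS|i y iS yL]; rewrite ffunE.
    by rewrite (negPf iS) u_off.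
  case: ifP => [/andP[_ muz]|_]; last exact: u_in.
  by have [_ v_dead _] := vP i iS muz; rewrite v_dead.
suff : h u' mu = 0.
  move=> u'0; case/eqP: nz; rewrite (upp u u') // => i; rewrite ffunE.
  by case: ifP => // /andP[iS muz]; have [-> _ _] := vP i iS muz.
apply: (vanishing_few_above zL LB _ res supp x0L mu Du').
  apply: IH => [|y]; first by move: lt_n; rewrite (cardsD1 z) zL.
  rewrite inE negb_and negbK inE; case: eqP => //= _ yL.
  exact: subset_trans (subsetDl _ _) (LB y yL).
(* Only the holders of [z] in [mu] were spared the demotion, hence the bound [q z]. *)
apply: leq_trans (assignment_cap mu z); apply/subset_leq_card/subsetP => i.
rewrite !inE ffunE => /andP[iS]; rewrite iS /=.
have [//|muz] := eqVneq (mu i) z; have [_ _ vz] := vP i iS muz.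
by rewrite vz eqxx.
Qed.

End Residual.

(** * Comparison of an arbitrary rule with Random Priority *)

Theorem proposition1 (R : realType) (N O : finType) (q : O -> nat)
  (q_gt0 : forall x, (0 < q x)%N)
  (capacity : (#|N| <= \sum_(x : O) q x)%N)
  (f : profile R N O -> distribution N q R) :
  (equal_treatment_of_equals f /\ ex_post_efficient f /\
   probabilistic_monotonicity f)
  <->
  (forall (u : profile R N O) (mu : assignment N q),
     f u mu = RP R (pref_profile u) mu).
Proof.
split=> [[ete [eff mono]] u mu|fRP]; last first.
  split=> [u i j uij mu mu' ij ji other|]; last split=> [u mu|u u' mu sub].
  - by rewrite (swapP ij ji other) !fRP RP_swap // /pref_profile uij.
  - by rewrite fRP; apply: RP_efficient.
  by rewrite !fRP; apply: RP_monotone.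
pose h (w : profile R N O) (nu : assignment N q) := f w nu - RP R (pref_profile w) nu.
pose B (y : O) : {set O} := setT.
(* With all agents free and all objects live, every profile is settled. *)
have res : residual (settled setT setT B u) setT h.
  split=> [w nu _ nz|w w' nu _ _ e|w _|w i j nu _ _ _ wij].
  - have [f0|f_gt0] := eqVneq (f w nu) 0.
      apply: (@RP_efficient _ _ _ R); rewrite lt0r RP_ge0 andbT.
      by apply: contraNneq nz => RP0; rewrite /h f0 RP0 subrr.
    by apply: eff; rewrite lt0r f_gt0 prob_ge0.
  (* Equal upper contour sets allow monotonicity to be used in both directions. *)
  - by congr (_ - _); apply: le_anti; rewrite ?mono ?RP_monotone // => i;
      rewrite /pref_profile e.
  - by rewrite sumrB prob_sum1 RP_sum1 ?subrr.
  rewrite /h RP_swap /pref_profile ?wij //; congr (_ - _); apply: (ete w j i) => //.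
  - by rewrite permutedE tpermR.
  - by rewrite permutedE tpermL.
  by move=> k kj ki; rewrite permutedE tpermD // eq_sym.
have van : vanishing R N q setT B.
  by apply: vanishing_settled => y; rewrite inE.
apply/eqP; rewrite -subr_eq0 -/(h u mu); apply/eqP.
apply: (van setT u mu h res) => [w nu _ _|i|]; last by split=> [i|i y _]; rewrite inE.
  by split=> i; rewrite inE.
by rewrite inE.
Qed.
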